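(* Let $p$ be a prime, $\mathbb{F}_p$ the field with $p$ elements, $n\ge 2$ and $1\le m\le n-1$ integers. For any real $\alpha$ with $\min\{m,n-m\}<\alpha\le m(n-m)$, there exists a subset $G\subset G(n,n-m)$ with $|G|\approx p^{\alpha}$ such that for every set $E\subset\mathbb{F}_p^n$ and every $N>0$, \[ |\{W\in G:\ |\pi^{W}(E)|\le N\}|\lesssim |G|\,N\,(|E|^{-1}+p^{-m}). \]
   Context: $G(n,k)$ denotes the set of all $k$-dimensional linear subspaces of $\mathbb{F}_p^n$. For a nontrivial subspace $W$ and $E\subset\mathbb{F}_p^n$, $\pi^{W}(E)=\{x+W:\ E\cap(x+W)\neq\emptyset,\ x\in\mathbb{F}_p^n\}$ is the set of cosets of $W$ meeting $E$, and $|\pi^W(E)|$ its cardinality. $|J|$ denotes cardinality. $f\lesssim g$ means $f\le Cg$ for a constant $C$ independent of $p$, $E$, $N$ (depending only on $n,m,\alpha$); $f\approx g$ means $f\lesssim g$ and $g\lesssim f$. *)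

(* Defs.v *)
From HB Require Import structures.
From mathcomp Require Import all_boot all_order all_algebra.
From Stdlib Require Import Reals.
Set Implicit Arguments. Unset Strict Implicit. Unset Printing Implicit Defensive.
Import GRing.Theory.

Definition Rleb (x y : R) : bool := if Rle_dec x y then true else false.

Local Open Scope ring_scope.

Definition coset_of_sub (F : finFieldType) (n : nat)
  (W : {vspace 'rV[F]_n}) (x : 'rV[F]_n) : {set 'rV[F]_n} :=
  [set y | (y - x) \in W].

Definition proj_cosets (F : finFieldType) (n : nat)
  (W : {vspace 'rV[F]_n}) (E : {set 'rV[F]_n}) : {set {set 'rV[F]_n}} :=
  [set coset_of_sub W x | x in E].

(* Main.v *)
Require Import Defs.
From mathcomp Require Import all_boot all_order all_algebra all_field.
From mathcomp Require Import zify.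
Set Implicit Arguments. Unset Strict Implicit. Unset Printing Implicit Defensive.
Import GRing.Theory.

(** If [|pi^W(E)| <= N], Cauchy-Schwarz gives at least [|E|^2 / N] pairs in [E^2]
    whose difference lies in [W], so it suffices to bound the average over [G] of
    this number of pairs (the energy) by a constant times [|E|^2 / p^m + |E|].

    Write [n = k + r] and attach to a [k x r] matrix [A] the graph [{(x, xA)}].
    For [t] in the field with [p^r] elements, take the matrix with rows
    [t, t^2, ..., t^k] (in coordinates over [F_p]) and add any [B] with zero first
    row.  For fixed [B], [x <> 0] and [y], the equation [xA = y] is a nonconstant
    polynomial equation in [t] of degree at most [k].  Letting [B] range over
    about [p^(alpha - r)] matrices gives about [p^alpha] distinct [A]'s, among which
    a [O(p^-r)] proportion satisfies [xA = y].

    With [r = m] (possible if [alpha >= m]) the graphs themselves work, by double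
    counting.  With [r = n - m] (possible if [alpha >= n - m]) one takes their
    orthogonal complements; the energy of the complement of [V] is a sum over
    [xi] in [V] of the nonnegative excess of the collisions of [x |-> <xi, x>] on
    [E], which replaces Plancherel. *)

(** * Cauchy-Schwarz and collisions of a map *)

Lemma sum_sqr_le (I : finType) (S : {set I}) (a : I -> nat) :
  (\sum_(i in S) a i) ^ 2 <= #|S| * \sum_(i in S) a i ^ 2.
Proof.
rewrite -(leq_pmul2l (isT : 0 < 2)) -mulnn big_distrlr /=.
rewrite big_distrr /=; under eq_bigr do rewrite big_distrr /=.
apply: (@leq_trans (\sum_(i in S) \sum_(j in S) (a i ^ 2 + a j ^ 2))).
  by apply: leq_sum => i _; apply: leq_sum => j _; apply: nat_Cauchy.
under eq_bigr do rewrite big_split /= sum_nat_const.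
by rewrite big_split /= sum_nat_const -big_distrr /= addnn -mul2n.
Qed.

Definition collisions (T T' : finType) (f : T -> T') (E : {set T}) : nat :=
  \sum_(x in E) \sum_(y in E) (f x == f y).

(** Cauchy-Schwarz for the fibre sizes, which sum to [|E|] and whose squares sum to the number of
    colliding pairs. *)
Lemma sqr_card_le_collisions (T T' : finType) (f : T -> T') (E : {set T}) :
  #|E| ^ 2 <= #|f @: E| * collisions f E.
Proof.
pose a j := \sum_(x in E | f x == j) 1.
have -> : collisions f E = \sum_(j in f @: E) a j ^ 2.
  rewrite /collisions (partition_big_imset f); apply: eq_bigr => j _.
  rewrite -mulnn {1}/a big_distrl /=; apply: eq_bigr => x /andP[_ /eqP->].
  rewrite mul1n /a big_mkcondr; apply: eq_bigr => y _.
  by rewrite eq_sym; case: eqP.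
rewrite -(sum1_card (mem E)) (partition_big_imset f).
exact: sum_sqr_le.
Qed.

(** * Linear functionals and row spaces over a finite field *)

Local Open Scope ring_scope.

(** A nonzero [w] gives a surjective functional, whose kernel has codimension 1. The factor [#|F|]
    on the left avoids the exponent [k - 1]. *)
Lemma sum_orthogonal (F : finFieldType) (k : nat) (w : 'cV[F]_k) :
  (#|F| * \sum_(u : 'rV[F]_k) (u *m w == 0)%R =
   #|F| ^ k * (if w == 0%R then #|F| else 1))%N.
Proof.
have [->|w0] := eqVneq w 0.
  rewrite mulnC; congr (_ * _)%N.
  under eq_bigr do rewrite mulmx0 eqxx.
  by rewrite sum1_card card_mx mul1n.
pose f : 'Hom('rV[F]_k, 'rV[F]_1) := linfun (mulmxr w).
have -> : (\sum_(u : 'rV[F]_k) (u *m w == 0)%R = #|F| ^ \dim (lker f))%N.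
  rewrite -card_vspace -sum1_card [RHS]big_mkcond /=; apply: eq_bigr => u _.
  by rewrite memv_ker lfunE /=; case: eqP.
have limf : limg f = fullv.
  apply/eqP; rewrite eqEdim subvf dimvf /dim /= muln1 /= lt0n dimv_eq0.
  apply/eqP => f0; case/eqP: w0; apply/colP => i.
  move: (memv_img f (memvf (delta_mx 0 i))).
  rewrite f0 memv0 lfunE /= -rowE => /eqP/rowP/(_ 0).
  by rewrite !mxE.
have := limg_ker_dim f fullv.
rewrite capfv limf !dimvf /dim /= muln1 mul1n => dk.
by rewrite muln1 -expnS -addn1 dk.
Qed.

Definition rowspace (F : fieldType) (a n : nat) (M : 'M[F]_(a, n)) :
    {vspace 'rV[F]_n} :=
  limg (linfun (mulmxr M) : 'Hom('rV[F]_a, 'rV[F]_n)).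

Lemma memv_rowspaceP (F : fieldType) (a n : nat) (M : 'M[F]_(a, n))
    (z : 'rV[F]_n) :
  reflect (exists u, z = u *m M) (z \in rowspace M).
Proof.
apply: (iffP memv_imgP) => [[u _]|[u ->]].
  by rewrite lfunE /=; exists u.
by exists u; rewrite ?memvf // lfunE.
Qed.

Lemma dim_rowspace (F : fieldType) (a n : nat) (M : 'M[F]_(a, n))
    (N : 'M[F]_(n, a)) :
  M *m N = 1%:M -> \dim (rowspace M) = a.
Proof.
move=> MN; rewrite limg_dim_eq ?dimvf /dim /= ?mul1n // capfv.
apply/eqP; rewrite -subv0; apply/subvP => u.
rewrite memv_ker lfunE memv0 /= => /eqP uM.
by rewrite -(mulmx1 u) -MN mulmxA uM mul0mx.
Qed.

(** * Graphs of matrices and their orthogonal complements *)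

Section Graphs.

Variables (F : finFieldType) (k r : nat).
Implicit Types (A : 'M[F]_(k, r)) (z : 'rV[F]_(k + r)).

Definition graph A : {vspace 'rV[F]_(k + r)} :=
  rowspace (row_mx 1%:M A).

(* The orthogonal complement of [graph A] for the standard bilinear form. *)
Definition cograph A : {vspace 'rV[F]_(k + r)} :=
  rowspace (row_mx (- A^T) 1%:M).

Lemma mem_graph A z : (z \in graph A) = (lsubmx z *m A == rsubmx z).
Proof.
apply/memv_rowspaceP/eqP => [[u ->]|zA].
  by rewrite mul_mx_row row_mxKl row_mxKr mulmx1.
by exists (lsubmx z); rewrite mul_mx_row mulmx1 zA hsubmxK.
Qed.

Lemma mem_cograph A z : (z \in cograph A) = (row_mx 1%:M A *m z^T == 0).
Proof.
rewrite -{2}[z]hsubmxK tr_row_mx mul_row_col mul1mx.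
apply/memv_rowspaceP/eqP => [[u ->]|zA].
  rewrite mul_mx_row row_mxKl row_mxKr mulmx1 mulmxN linearN /=.
  by rewrite trmx_mul trmxK addNr.
exists (rsubmx z); rewrite mul_mx_row mulmx1 -[LHS]hsubmxK; congr row_mx.
move/eqP: zA; rewrite addr_eq0 => /eqP zA.
by apply: trmx_inj; rewrite zA mulmxN linearN /= trmx_mul trmxK.
Qed.

Lemma dim_graph A : \dim (graph A) = k.
Proof.
apply: (@dim_rowspace _ _ _ _ (col_mx 1%:M 0)).
by rewrite mul_row_col mulmx1 mulmx0 addr0.
Qed.

Lemma dim_cograph A : \dim (cograph A) = r.
Proof.
apply: (@dim_rowspace _ _ _ _ (col_mx 0 1%:M)).
by rewrite mul_row_col mulmx1 mulmx0 add0r.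
Qed.

Lemma graph_inj : injective graph.
Proof.
move=> A B AB; apply/row_matrixP => i; rewrite !rowE.
have: row_mx (delta_mx 0 i) (delta_mx 0 i *m A) \in graph A.
  by rewrite mem_graph row_mxKl row_mxKr.
by rewrite AB mem_graph row_mxKl row_mxKr => /eqP.
Qed.

Lemma cograph_inj : injective cograph.
Proof.
move=> A B AB; apply: trmx_inj; apply/row_matrixP => i; rewrite !rowE.
have: row_mx (- (delta_mx 0 i *m A^T)) (delta_mx 0 i) \in cograph A.
  rewrite mem_cograph tr_row_mx mul_row_col mul1mx linearN /= trmx_mul trmxK.
  by rewrite addNr.
rewrite AB mem_cograph tr_row_mx mul_row_col mul1mx linearN /= trmx_mul trmxK.
rewrite addrC subr_eq0 => /eqP /(congr1 trmx).
by rewrite !trmx_mul !trmxK.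
Qed.

End Graphs.

(** * Energy of a subspace and excess of collisions *)

Section Energy.

Variables (F : finFieldType) (n : nat).
Implicit Types (W : {vspace 'rV[F]_n}) (E : {set 'rV[F]_n}).

Definition energy W E : nat := \sum_(x in E) \sum_(y in E) (x - y \in W)%R.

Lemma eq_coset_of_sub W (x y : 'rV[F]_n) :
  (coset_of_sub W x == coset_of_sub W y) = (x - y \in W).
Proof.
apply/eqP/idP => [/setP/(_ x)|xy].
  by rewrite !inE subrr mem0v => <-.
by apply/setP => z; rewrite !inE -(rpredDr (z - x) xy) addrA subrK.
Qed.

Lemma sqr_card_le_energy W E : (#|E| ^ 2 <= #|proj_cosets W E| * energy W E)%N.
Proof.
apply: leq_trans (sqr_card_le_collisions (coset_of_sub W) E) _.
rewrite leq_mul2l; apply/orP; right.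
by apply: leq_sum => x _; apply: leq_sum => y _; rewrite eq_coset_of_sub.
Qed.

(* [#|F|] times the excess of the number of collisions over its lower bound
   [#|E|^2 / #|F|]; the truncated subtraction is exact by [excess_ge]. *)
Definition excess E (xi : 'rV[F]_n) : nat :=
  #|F| * collisions (fun z : 'rV[F]_n => xi *m z^T) E - #|E| ^ 2.

Lemma excess_ge E (xi : 'rV[F]_n) :
  (#|E| ^ 2 <= #|F| * collisions (fun z : 'rV[F]_n => xi *m z^T) E)%N.
Proof.
apply: leq_trans (sqr_card_le_collisions (fun z : 'rV[F]_n => xi *m z^T) E) _.
rewrite leq_mul2r; apply/orP; right.
by apply: leq_trans (max_card _) _; rewrite card_mx.
Qed.

(** After exchanging sums, each pair [(x, y)] counts the [u] orthogonal to [M *m (x - y)^T],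
    evaluated by [sum_orthogonal]; the part common to all pairs cancels the subtracted term. *)
Lemma sum_excess (a : nat) (M : 'M[F]_(a, n)) E :
  (\sum_(u : 'rV[F]_a) excess E (u *m M) =
   #|F| ^ a * (#|F| - 1) *
     \sum_(x in E) \sum_(y in E) (M *m (x - y)^T == 0)%R)%N.
Proof.
rewrite /excess sumnB; last by move=> u _; apply: excess_ge.
rewrite -big_distrr /= sum_nat_const card_mx mul1n.
rewrite [X in (#|F| * X)%N](_ : _ = \sum_(x in E) \sum_(y in E)
    \sum_(u : 'rV[F]_a) (u *m (M *m (x - y)^T) == 0)%R)%N; last first.
  rewrite /collisions exchange_big; apply: eq_bigr => x _.
  rewrite exchange_big; apply: eq_bigr => y _; apply: eq_bigr => u _.
  by rewrite mulmxA linearB /= mulmxBr subr_eq0.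
rewrite big_distrr /=; under eq_bigr do rewrite big_distrr /=.
have F0 : (0 < #|F|)%N by apply/card_gt0P; exists 0%R.
transitivity (\sum_(x in E) \sum_(y in E)
   (#|F| ^ a + #|F| ^ a * (#|F| - 1) * (M *m (x - y)^T == 0)%R)
     - #|F| ^ a * #|E| ^ 2)%N.
  congr (_ - _)%N; apply: eq_bigr => x _; apply: eq_bigr => y _.
  rewrite sum_orthogonal; case: eqP => _; last by rewrite muln0 addn0 muln1.
  by rewrite muln1 addnC -mulnSr -subSn // subn1.
under eq_bigr do rewrite big_split /= -big_distrr /= sum_nat_const.
rewrite big_split /= -big_distrr /= sum_nat_const -mulnn.
by rewrite mulnA [X in (X + _ - _)%N]mulnC addKn -big_distrr.
Qed.

End Energy.

(** * Total energy over a family of matrices *)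

Section FamilyEnergy.

Variables (F : finFieldType) (k r c : nat) (S : seq 'M[F]_(k, r)).
Hypothesis count_eval : forall (x : 'rV[F]_k) (y : 'rV[F]_r),
  x != 0 -> (count (fun A => x *m A == y) S <= c)%N.
Implicit Types E : {set 'rV[F]_(k + r)}.

(** Each diagonal pair counts once per matrix, each other pair for at most [c] matrices. *)
Lemma sum_energy_graph E :
  (\sum_(A <- S) energy (graph A) E <= size S * #|E| + c * #|E| ^ 2)%N.
Proof.
rewrite /energy exchange_big /= -mulnn mulnA [leqRHS]addnC -mulnDl mulnC.
rewrite -sum_nat_const; apply: leq_sum => x xE.
rewrite exchange_big /= (bigD1 x) //= [leqRHS]addnC leq_add //.
  rewrite -sum1_size; apply: leq_sum => A _; exact: leq_b1.
apply: (@leq_trans (\sum_(y in E | y != x) c)%N); last first.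
  rewrite sum_nat_const mulnC leq_mul2l; apply/orP; right.
  by apply: subset_leq_card; apply/subsetP => y /andP[].
apply: leq_sum => y /andP[_ yx].
under eq_bigr do rewrite mem_graph.
(* A graph contains no nonzero vector with zero left part, so the case [x0] contributes nothing. *)
have [x0|x0] := eqVneq (lsubmx (x - y)) 0; last first.
  apply: leq_trans (count_eval (rsubmx (x - y)) x0); rewrite -sum1_count.
  by rewrite [leqRHS]big_mkcond; apply: leq_sum => A _; case: eqP.
rewrite big1 // => A _; rewrite x0 mul0mx.
case: eqP => // y0; case/eqP: yx; apply/eqP; rewrite eq_sym -subr_eq0.
by rewrite -[x - y]hsubmxK x0 -y0 row_mx0.
Qed.

(** Up to a factor, the energy of a complement is the sum of the excesses over the graph. The zero
    vector yields the [|E|^2] term; a vector with nonzero left part lies in the graphs of at most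
    [c] entries of [S]. *)
Lemma sum_energy_cograph E :
  (#|F| ^ k * \sum_(A <- S) energy (cograph A) E
     <= size S * #|E| ^ 2 + c * #|F| ^ (k + r) * #|E|)%N.
Proof.
have F1 : (0 < #|F| - 1)%N by rewrite subn_gt0 finNzRing_gt1.
rewrite -(leq_pmul2l F1) mulnA [(_ * #|F| ^ k)%N]mulnC big_distrr /=.
have en A : (#|F| ^ k * (#|F| - 1) * energy (cograph A) E =
   \sum_(u : 'rV[F]_k) excess E (row_mx u (u *m A)))%N.
  under [RHS]eq_bigr => u _ do rewrite -{1}(mulmx1 u) -mul_mx_row.
  rewrite sum_excess; congr (_ * _)%N.
  by apply: eq_bigr => x _; apply: eq_bigr => y _; rewrite mem_cograph.
under eq_bigr do rewrite en.
rewrite exchange_big /= (bigD1 0) //= mulnDr leq_add //.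
  rewrite [leqRHS](_ : _ = \sum_(A <- S) (#|F| - 1) * #|E| ^ 2)%N; last first.
    by rewrite big_const_seq count_predT iter_addn_0 mulnCA mulnC.
  apply: leq_sum => A _; rewrite mul0mx row_mx0 /excess /collisions.
  under eq_bigr do under eq_bigr do rewrite !mul0mx eqxx.
  by rewrite !sum_nat_const muln1 mulnn mulnBl mul1n.
(* As the excess is nonnegative, the sum may be extended to all vectors, where [sum_excess] with the
   identity matrix leaves only diagonal pairs. *)
apply: (@leq_trans (\sum_(u : 'rV[F]_k) \sum_(y : 'rV[F]_r)
  c * excess E (row_mx u y))%N); last first.
  under eq_bigr do rewrite -big_distrr /=.
  rewrite -big_distrr /= pair_bigA /=.
  rewrite (reindex (fun z : 'rV[F]_(k + r) => (lsubmx z, rsubmx z))) /=;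
    last first.
    exists (fun uy => row_mx uy.1 uy.2) => [z _|[u y] _] /=.
      by rewrite hsubmxK.
    by rewrite row_mxKl row_mxKr.
  rewrite (eq_bigr (fun z => excess E (z *m 1%:M))); last first.
    by move=> z _; rewrite hsubmxK mulmx1.
  rewrite sum_excess [X in (_ * (_ * X) <= _)%N](_ : _ = #|E|).
    by rewrite -!mulnA (mulnCA (#|F| ^ _)%N) mulnCA.
  rewrite -sum1_card; apply: eq_bigr => x xE; rewrite (bigD1 x) //= subrr.
  rewrite trmx0 mulmx0 eqxx big1 // => y /andP[_ yx]; rewrite mul1mx.
  by rewrite -trmx0 (inj_eq trmx_inj) subr_eq0 eq_sym (negPf yx).
apply: (@leq_trans (\sum_(u : 'rV[F]_k | (u != 0)%R)
  \sum_(y : 'rV[F]_r) c * excess E (row_mx u y))%N).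
  apply: leq_sum => u u0.
  rewrite (partition_big (fun A => u *m A) xpredT) //=.
  apply: leq_sum => y _.
  under eq_bigr => A /eqP-> do [].
  rewrite big_const_seq iter_addn_0 mulnC leq_mul2r count_eval ?orbT //.
by rewrite [leqRHS](bigD1 0) //= leq_addl.
Qed.

End FamilyEnergy.

(** * Matrices built from powers of a field element *)

Section PowerMatrices.

Variables (F : finFieldType) (L : fieldExtType F) (k r : nat).
Variable phi : {linear L -> 'rV[F]_r}.
Hypothesis phi_inj : injective phi.

(** Exponents start at 1, so that a nonzero [x] gives a nonconstant polynomial in [t]. *)
Definition powmx (t : L) : 'M[F]_(1 + k, r) := \matrix_i phi (t ^+ i.+1).

Lemma mul_powmx (x : 'rV[F]_(1 + k)) (t : L) :
  x *m powmx t = phi (\sum_i x 0 i *: t ^+ i.+1).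
Proof.
rewrite mulmx_sum_row linear_sum; apply: eq_bigr => i _.
by rewrite rowK linearZ.
Qed.

Lemma count_powmx (x : 'rV[F]_(1 + k)) (y : 'rV[F]_r) (ts : seq L) :
  x != 0 -> uniq ts -> (count (fun t => x *m powmx t == y) ts <= k.+1)%N.
Proof.
move=> x0 uts; rewrite -size_filter.
case Ds: [seq _ <- _ | _] => [//|t0 s]; rewrite -Ds.
have t0y: x *m powmx t0 = y.
  apply/eqP; have: t0 \in [seq t <- ts | x *m powmx t == y].
    by rewrite Ds mem_head.
  by rewrite mem_filter => /andP[].
pose P : {poly L} := \sum_(i < 1 + k) (x 0 i)%:A *: 'X^(i.+1).
have PE t : P.[t] = \sum_i x 0 i *: t ^+ i.+1.
  rewrite horner_sum; apply: eq_bigr => i _.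
  by rewrite hornerZ hornerXn -scalerAl mul1r.
(* [y] may lie outside the image of [phi], so the constant to subtract comes from a first solution
   [t0]; every solution is then a root of [Q]. *)
pose Q := P - P.[t0]%:P.
have Q0 : Q != 0.
  have [i xi] : exists i, x 0 i != 0.
    apply/existsP; apply: contraNT x0; rewrite negb_exists => /forallP x0.
    by apply/eqP/rowP => i; rewrite mxE; apply/eqP; move: (x0 i); rewrite negbK.
  apply: contraNneq xi => /polyP/(_ i.+1).
  rewrite coefB coefC subr0 coef0 coef_sum (bigD1 i) //= coefZ coefXn eqxx mulr1.
  rewrite big1 => [|j ji]; last first.
    by rewrite coefZ coefXn eqSS eq_sym (negPf (_ : val j != val i)) ?mulr0.
  by rewrite addr0 => /eqP; rewrite scaler_eq0 oner_eq0 orbF.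
have sQ : (size Q <= k.+2)%N.
  rewrite (leq_trans (size_polyD _ _)) // geq_max size_polyN.
  rewrite (leq_trans (size_polyC_leq1 _)) // andbT.
  apply: leq_trans (size_sum _ _ _) _; apply/bigmax_leqP => i _.
  by rewrite (leq_trans (size_scale_leq _ _)) // size_polyXn !ltnS -ltnS.
rewrite -ltnS; apply: leq_trans sQ; apply: max_poly_roots => //; last first.
  exact: filter_uniq.
apply/allP => t; rewrite mem_filter => /andP[/eqP ty _].
rewrite rootE hornerD hornerN hornerC subr_eq0; apply/eqP/phi_inj.
by rewrite !PE -!mul_powmx ty.
Qed.

Definition powmx_family (ts : seq L) (Bs : seq 'M[F]_(k, r)) :
    seq 'M[F]_(1 + k, r) :=
  [seq powmx t + col_mx 0 B | B <- Bs, t <- ts].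

Lemma size_powmx_family ts Bs :
  size (powmx_family ts Bs) = (size ts * size Bs)%N.
Proof. by rewrite size_allpairs mulnC. Qed.

(** The first row is [phi t], which determines [t], and then [B]. *)
Lemma uniq_powmx_family ts Bs : uniq ts -> uniq Bs -> uniq (powmx_family ts Bs).
Proof.
move=> uts uBs; apply: allpairs_uniq => // -[B t] [B' t'] _ _ /= eqBt.
have tt' : t = t'.
  have := congr1 usubmx eqBt; rewrite !linearD /= !col_mxKu !addr0 => /rowP eqr.
  by apply: phi_inj; apply/rowP => j; move: (eqr j); rewrite !mxE.
by move: eqBt; rewrite tt' => /addrI /eq_col_mx[_ ->].
Qed.

Lemma count_powmx_family ts Bs (x : 'rV[F]_(1 + k)) (y : 'rV[F]_r) :
  x != 0 -> uniq ts ->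
  (count (fun A => x *m A == y) (powmx_family ts Bs) <= k.+1 * size Bs)%N.
Proof.
move=> x0 uts; elim: Bs => [|B Bs IH] //=.
rewrite count_cat mulnS leq_add // count_map.
apply: leq_trans (count_powmx (y - x *m col_mx 0 B) x0 uts).
by apply: sub_count => t /=; rewrite mulmxDr => /eqP <-; rewrite addrK.
Qed.

End PowerMatrices.

(** * The field with [p ^ r] elements in coordinates *)

Section FieldExtension.

Import VectorInternalTheory.

Lemma fieldExt_of_degree (p r : nat) : prime p -> (0 < r)%N ->
  exists (L : fieldExtType 'F_p) (ts : seq L) (phi : {linear L -> 'rV['F_p]_r}),
    [/\ uniq ts, size ts = (p ^ r)%N & injective phi].
Proof.
move=> pp r0; have [Fm chF cF] := pPrimePowerField pp r0.
pose L : fieldExtType 'F_p := pPrimeCharType chF.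
have dL : dim L = r by rewrite -(pfactorK r pp) -cF -(pprimeChar_dimf chF) dimvf.
(* Replacing [r] by [dim L] makes the coordinate map [v2r] well typed. *)
exists L, (enum Fm); move: cF; case: _ / dL => cF.
exists v2r.
by split; [exact: enum_uniq | rewrite -cardE cF | exact: v2r_inj].
Qed.

End FieldExtension.

(** * The two families of subspaces *)

Lemma evaluation_family (p k r b : nat) :
  prime p -> (0 < k)%N -> (0 < r)%N -> (b <= p ^ ((k - 1) * r))%N ->
  exists S : seq 'M['F_p]_(k, r),
    [/\ uniq S, size S = (p ^ r * b)%N &
        forall (x : 'rV_k) (y : 'rV_r), x != 0 ->
          (count (fun A => x *m A == y) S <= k * b)%N].
Proof.
case: k => // k pp _ r0; rewrite subSS subn0 => leb.
have [L [ts [phi [uts sts phi_inj]]]] := fieldExt_of_degree pp r0.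
pose Bs := take b (enum 'M['F_p]_(k, r)).
have sBs : size Bs = b.
  by rewrite size_takel // -cardE card_mx card_Fp.
exists (powmx_family phi ts Bs); split.
- by apply: uniq_powmx_family => //; apply/take_uniq/enum_uniq.
- by rewrite size_powmx_family sts sBs.
- by move=> x y x0; have := count_powmx_family phi_inj Bs y x0 uts; rewrite sBs.
Qed.

(** Average energy at most [n * (|E|^2 / |F|^m + |E|)], cleared of denominators; the factor [n]
    absorbs the degree of the polynomials. *)
Definition low_energy (F : finFieldType) (n m : nat) (G : seq {vspace 'rV[F]_n}) :=
  forall E : {set 'rV[F]_n},
    (#|F| ^ m * \sum_(W <- G) energy W E
       <= n * size G * (#|E| ^ 2 + #|F| ^ m * #|E|))%N.

Lemma graph_family (p k m b : nat) :
  prime p -> (0 < k)%N -> (0 < m)%N -> (b <= p ^ ((k - 1) * m))%N ->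
  exists G : seq {vspace 'rV['F_p]_(k + m)},
    [/\ uniq G, all (fun W => \dim W == k) G, size G = (p ^ m * b)%N
      & low_energy m G].
Proof.
move=> pp k0 m0 leb; have [S [uS sS cS]] := evaluation_family pp k0 m0 leb.
exists [seq graph A | A <- S]; split.
- by rewrite (map_inj_uniq (@graph_inj _ _ _)).
- by apply/allP => _ /mapP[A _ ->]; rewrite dim_graph.
- by rewrite size_map.
move=> E; rewrite big_map size_map card_Fp //.
have := leq_mul (leqnn (p ^ m)%N) (sum_energy_graph cS E).
move=> /leq_trans; apply; rewrite sS.
set q := (p ^ m)%N; set e := #|E|; move: q e => q e; nia.
Qed.

Lemma cograph_family (p m r b : nat) :
  prime p -> (0 < m)%N -> (0 < r)%N -> (b <= p ^ ((m - 1) * r))%N ->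
  exists G : seq {vspace 'rV['F_p]_(m + r)},
    [/\ uniq G, all (fun W => \dim W == r) G, size G = (p ^ r * b)%N
      & low_energy m G].
Proof.
move=> pp m0 r0 leb; have [S [uS sS cS]] := evaluation_family pp m0 r0 leb.
exists [seq cograph A | A <- S]; split.
- by rewrite (map_inj_uniq (@cograph_inj _ _ _)).
- by apply/allP => _ /mapP[A _ ->]; rewrite dim_cograph.
- by rewrite size_map.
move=> E; rewrite big_map size_map.
apply: leq_trans (sum_energy_cograph cS E) _.
rewrite sS card_Fp // expnD.
move: (p ^ m)%N (p ^ r)%N #|E| => q s e; nia.
Qed.

(* Passage to real exponents and real bounds *)
Local Close Scope ring_scope.
From Stdlib Require Import Reals Lra.

Lemma INR_expn (p m : nat) : INR (expn p m) = (INR p ^ m)%R.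
Proof. by elim: m => [|m IH] //; rewrite expnS mult_INR IH. Qed.

Lemma le_INR_leq (a b : nat) : leq a b -> (INR a <= INR b)%R.
Proof. by move=> /leP/le_INR. Qed.

Lemma floor_Rpower (p c : nat) (beta : R) :
  leq 1 p -> (0 <= beta <= INR c)%R ->
  exists b : nat, [/\ leq b (expn p c),
    (Rpower (INR p) beta / 2 <= INR b)%R & (INR b <= Rpower (INR p) beta)%R].
Proof.
move=> p0 [beta0 betac].
have p1 : (1 <= INR p)%R := le_INR_leq p0.
have P1 : (1 <= Rpower (INR p) beta)%R.
  by rewrite -(Rpower_O (INR p)); [apply: Rle_Rpower | lra].
have PC : (Rpower (INR p) beta <= INR (expn p c))%R.
  by rewrite INR_expn -Rpower_pow; [apply: Rle_Rpower | lra].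
have [lo hi] := base_Int_part (Rpower (INR p) beta).
have z0 : (0 <= Int_part (Rpower (INR p) beta))%Z.
  suff: (-1 < Int_part (Rpower (INR p) beta))%Z by lia.
  by apply: lt_IZR; lra.
exists (Z.to_nat (Int_part (Rpower (INR p) beta))).
have bE : INR (Z.to_nat (Int_part (Rpower (INR p) beta)))
          = IZR (Int_part (Rpower (INR p) beta)) by rewrite INR_IZR_INZ Znat.Z2Nat.id.
(* An integer part at least 1 is at least half of the number, whence the factor 2. *)
have b1 : (1 <= IZR (Int_part (Rpower (INR p) beta)))%R.
  suff: (0 < Int_part (Rpower (INR p) beta))%Z by move=> z1; apply: IZR_le; lia.
  by apply: lt_IZR; lra.
split; rewrite ?bE; [|lra|lra].
by apply/leP/INR_le; rewrite bE; lra.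
Qed.

(** Each counted [W] has [|E|^2] at most [N] times its energy; the other terms on the right are
    nonnegative. *)
Lemma count_energy (F : finFieldType) (n : nat) (G : seq {vspace 'rV[F]_n})
    (E : {set 'rV[F]_n}) (N : R) :
  (0 < N)%R ->
  (INR (count (fun W => Rleb (INR #|proj_cosets W E|) N) G) * INR #|E| ^ 2
     <= N * INR (\sum_(W <- G) energy W E))%R.
Proof.
move=> N0; elim: G => [|W G IH] /=; first by rewrite big_nil /=; lra.
rewrite big_cons !plus_INR.
have e0 : (0 <= INR (energy W E))%R := pos_INR _.
have := le_INR_leq (sqr_card_le_energy W E).
rewrite INR_expn mult_INR => CS.
rewrite Rmult_plus_distr_r Rmult_plus_distr_l; apply: Rplus_le_compat => //.
rewrite /Rleb; case: Rle_dec => /= [WN|_].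
  by rewrite Rmult_1_l; apply: Rle_trans CS _; apply: Rmult_le_compat_r.
by rewrite Rmult_0_l; apply: Rmult_le_pos e0; apply: Rlt_le.
Qed.

Lemma projection_bound (F : finFieldType) (n m : nat) (G : seq {vspace 'rV[F]_n})
    (E : {set 'rV[F]_n}) (N : R) :
  low_energy m G -> E != set0 -> (0 < N)%R ->
  (INR (count (fun W => Rleb (INR #|proj_cosets W E|) N) G)
     <= INR n * INR (size G) * N * (/ INR #|E| + / (INR #|F| ^ m)))%R.
Proof.
move=> lowG E0 N0.
have := count_energy G E N0.
have := le_INR_leq (lowG E); rewrite !mult_INR plus_INR !INR_expn mult_INR INR_expn.
have : (0 < INR #|E|)%R by apply: (lt_INR 0); apply/ltP; rewrite card_gt0.
have : (0 < INR #|F| ^ m)%R.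
  by apply: pow_lt; apply: (lt_INR 0); apply/ltP/ltnW/finNzRing_gt1.
set q := (INR #|F| ^ m)%R; set e := INR #|E|.
set c := INR (count _ _); set s := INR (\sum_(W <- G) _)%N.
set g := (INR n * INR (size G))%R => q0 e0 le_s le_c.
apply: (Rmult_le_reg_r (q * e ^ 2)); first exact: Rmult_lt_0_compat q0 (pow_lt _ 2 e0).
have -> : (g * N * (/ e + / q) * (q * e ^ 2) = N * (g * (e ^ 2 + q * e)))%R.
  by field; lra.
apply: (Rle_trans _ (N * (q * s))); last by apply: Rmult_le_compat_l => //; lra.
have := Rmult_le_compat_l _ _ _ (Rlt_le _ _ q0) le_c; lra.
Qed.

(** * Choice of the family by comparing [m] with [n - m] *)

Theorem theorem1p3 (n m : nat) (alpha : R) :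
  (2 <= n)%N -> (1 <= m)%N -> (m <= n - 1)%N ->
  (INR (minn m (n - m)) < alpha)%R -> (alpha <= INR (m * (n - m)))%R ->
  exists C1 C2 C3 : R, (0 < C1)%R /\ (0 < C2)%R /\ (0 < C3)%R /\
  forall p : nat, prime p ->
  exists G : seq {vspace 'rV['F_p]_n},
    uniq G /\ all (fun W => \dim W == (n - m)%N) G /\
    (C1 * Rpower (INR p) alpha <= INR (size G))%R /\
    (INR (size G) <= C2 * Rpower (INR p) alpha)%R /\
    forall (E : {set 'rV['F_p]_n}) (N : R),
      E != set0 -> (0 < N)%R ->
      (INR (count (fun W => Rleb (INR #|proj_cosets W E|) N) G)
        <= C3 * INR (size G) * N * (/ INR #|E| + / (INR p ^ m)))%R.
Proof.
move=> n2 m1 mn alpha_gt alpha_le.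
(* [1 / 2] is the loss from rounding in [floor_Rpower]; [n] is the constant of [low_energy]. *)
exists (1 / 2)%R, 1%R, (INR n); split; [lra | split; [lra | split]].
  by apply: (lt_INR 0); apply/ltP; lia.
move=> p pp.
have pgt0 := prime_gt0 pp.
have p0 : (0 < INR p)%R by apply: (lt_INR 0); apply/ltP.
suff [r [b [G [uG dG sG lowG] [b1 b2]]]] :
    exists r b : nat, exists2 G : seq {vspace 'rV['F_p]_n},
    [/\ uniq G, all (fun W => \dim W == (n - m)%N) G, size G = muln (expn p r) b
      & low_energy m G]
    & (Rpower (INR p) (alpha - INR r) / 2 <= INR b
         <= Rpower (INR p) (alpha - INR r))%R.
  exists G; do 2!split=> //.
  have pa : Rpower (INR p) alpha =
      (INR (expn p r) * Rpower (INR p) (alpha - INR r))%R.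
    by rewrite INR_expn -Rpower_pow // -Rpower_plus; congr Rpower; lra.
  have q0 : (0 < INR (expn p r))%R by rewrite INR_expn; apply: pow_lt.
  rewrite sG mult_INR pa; split; [nra | split; [nra | move=> E N E0 N0]].
  have := projection_bound lowG E0 N0.
  by rewrite card_Fp // sG mult_INR.
have [k kE] : exists k, n - m = k by exists (n - m).
have k0 : 0 < k by lia.
rewrite kE in alpha_gt alpha_le *.
case: (leqP m k) => mk.
- have nE : n = k + m by lia.
  subst n; rewrite (minn_idPl mk) in alpha_gt.
  (* [alpha > m] makes the exponent nonnegative, and [alpha <= m * k] leaves enough matrices [B]. *)
  have [|b [leb b1 b2]] := @floor_Rpower p ((k - 1) * m) (alpha - INR m) pgt0.
    have mkE : m * k = (k - 1) * m + m.
      by rewrite mulnBl mul1n mulnC subnK // leq_pmull.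
    by move: alpha_le; rewrite mkE plus_INR; lra.
  have [G GP] := graph_family pp k0 m1 leb.
  by exists m, b, G.
- have nE : n = m + k by lia.
  subst n; rewrite (minn_idPr (ltnW mk)) in alpha_gt.
  have [|b [leb b1 b2]] := @floor_Rpower p ((m - 1) * k) (alpha - INR k) pgt0.
    have mkE : m * k = (m - 1) * k + k.
      by rewrite mulnBl mul1n subnK // leq_pmull.
    by move: alpha_le; rewrite mkE plus_INR; lra.
  have [G GP] := cograph_family pp m1 k0 leb.
  by exists k, b, G.
Qed.
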